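(* For each integer $a\geq 2$, the function $h\mapsto S_a(h)$ on nonnegative integers extends uniquely to a polynomial with rational coefficients, of degree $e_a$ (also denoted $S_a$). Set $\beta_a=0$ if $a\equiv 3\pmod 4$ and $\beta_a=1$ otherwise. There is a unique nonzero even polynomial $s_a(c)\in\mathbb{Q}[c]$ such that, as an identity of polynomials in $c$, $$S_a(c-a/2)=c^{\beta_a}\binom{c+a/2-1}{a-1}\,s_a(c).$$ With $m_a=e_a-a+1-\beta_a$, its degree and denominator satisfy $$\deg s_a=m_a,\qquad \operatorname{den}(s_a)\ \Bigm|\ \begin{cases} e_a!/(a-1)!, & a\text{ even},\\ 2^{m_a}\,e_a!/(a-1)!, & a\text{ odd}.\end{cases}$$
   Context: Write $[a]=\{1,\ldots,a\}$. A plane partition in an $(a,a,H)$-box is an integer matrix $\pi=(\pi_{ij})_{(i,j)\in[a]^2}$ with $0\leq\pi_{ij}\leq H$ for all $i,j$, $\pi_{ij}\geq\pi_{i+1,j}$ for $1\leq i<a$, $1\leq j\leq a$, and $\pi_{ij}\geq\pi_{i,j+1}$ for $1\leq i\leq a$, $1\leq j<a$. Let $\tau(i,j)=(a+1-j,a+1-i)$ on $[a]^2$. For an integer $h\geq0$, $\mathcal{S}_a(h)$ is the set of plane partitions in an $(a,a,2h)$-box such that $\pi_{ij}+\pi_{\tau(i,j)}=2h$ whenever $i\neq j$ and $\pi_{ij}=\pi_{ji}$ for all $i,j$; put $S_a(h)=|\mathcal{S}_a(h)|$. Put $e_a=\lfloor (a+1)^2/4\rfloor$. For $f\in\mathbb{Q}[c]$,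 $\operatorname{den}(f)$ is the least positive integer $D$ such that $Df$ has integer coefficients. Binomials are polynomials: $\binom{x}{k}=\frac{x(x-1)\cdots(x-k+1)}{k!}$, $\binom{x}{0}=1$. A polynomial $p$ is even if $p(-c)=p(c)$. *)

(* Defs.v *)
From mathcomp Require Import all_boot all_order all_algebra.

Set Implicit Arguments.
Unset Strict Implicit.
Unset Printing Implicit Defensive.

Import Order.TTheory GRing.Theory Num.Theory.

Local Open Scope nat_scope.

(* Rows and columns are indexed from 0, and an entry in [0, H] is an element
   of 'I_H.+1. *)
Definition plane_partition (a H : nat) (p : 'M['I_H.+1]_a) : bool :=
  [forall i : 'I_a, forall i' : 'I_a, forall j : 'I_a,
     (i' == i.+1 :> nat) ==> (p i' j <= p i j)] &&
  [forall i : 'I_a, forall j : 'I_a, forall j' : 'I_a,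
     (j' == j.+1 :> nat) ==> (p i j' <= p i j)].

(* With indices from 0, a + 1 - i becomes a - 1 - i, which is rev_ord. *)
Definition tau (a : nat) (ij : 'I_a * 'I_a) : 'I_a * 'I_a :=
  (rev_ord ij.2, rev_ord ij.1).

Definition S_set (a h : nat) : {set 'M['I_(2 * h).+1]_a} :=
  [set p : 'M['I_(2 * h).+1]_a |
     [&& plane_partition p,
         [forall i, forall j,
            (i != j) ==>
              (p i j + p (tau (i, j)).1 (tau (i, j)).2 == 2 * h)] &
         [forall i, forall j, p i j == p j i]]].

Definition S_count (a h : nat) : nat := #|S_set a h|.

Definition e_ (a : nat) : nat := (a + 1) ^ 2 %/ 4.

Definition beta_ (a : nat) : nat := if a %% 4 == 3 then 0 else 1.

(* For a >= 2 none of these subtractions is truncated. *)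
Definition m_ (a : nat) : nat := e_ a - a + 1 - beta_ a.

Local Open Scope ring_scope.

Definition binom_poly (x : {poly rat}) (k : nat) : {poly rat} :=
  (k`!%:R)^-1 *: \prod_(i < k) (x - (i%:R)%:P).

Definition even_polynomial (p : {poly rat}) : Prop := p \Po (- 'X) = p.

Lemma den_exists (f : {poly rat}) :
  exists D : nat, (0 < D)%N && (D%:R *: f \is a polyOver Num.int).
Proof.
exists (\prod_(i < size f) `|denq f`_i|)%N.
rewrite prodn_gt0 => [|i]; last by rewrite absz_gt0 denq_neq0.
apply/polyOverP => i; rewrite coefZ.
case: (ltnP i (size f)) => [lt_i|le_i]; last by rewrite nth_default // mulr0.
rewrite (bigD1 (Ordinal lt_i)) //= natrM -mulrA mulrCA rpredM //.
  by rewrite natr_int.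
have -> : `|denq f`_i|%N%:R = (denq f`_i)%:~R :> rat.
  by rewrite -[RHS](_ : (`|denq f`_i|%N : int)%:~R = _) // absz_denq.
by rewrite mulrC -{1}(divq_num_den f`_i) divfK ?intr_eq0 ?denq_neq0 ?intr_int.
Qed.

Definition den (f : {poly rat}) : nat := ex_minn (den_exists f).

Definition extends_S (a : nat) (P : {poly rat}) : Prop :=
  forall h : nat, P.[h%:R] = (S_count a h)%:R.

Definition factor_s (a : nat) (P s : {poly rat}) : Prop :=
  [/\ s != 0, even_polynomial s &
      P \Po ('X - (a%:R / 2%:R)%:P) =
        'X ^+ beta_ a * binom_poly ('X + (a%:R / 2%:R)%:P - 1) a.-1 * s].

(* (a - 1)! divides e_a!, so this quotient is exact. *)
Definition den_bound (a : nat) : nat :=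
  if odd a then (2 ^ m_ a * ((e_ a)`! %/ (a.-1)`!))%N
  else ((e_ a)`! %/ (a.-1)`!)%N.

(* Main.v *)
Require Import Defs.
From mathcomp Require Import all_boot all_order all_algebra.
From mathcomp Require Import zify ring.

Set Implicit Arguments.
Unset Strict Implicit.
Unset Printing Implicit Defensive.

(** By the two symmetries, a partition counted by [S_count a h] is determined by
its diagonal and by the entries above both the diagonal and the antidiagonal;
off the diagonal, the entries on the antidiagonal all equal [h].  Measure the
remaining entries by their distance to [h].  They form an order-reversing
function with values in [0, h] on a finite poset of cells with [e_ a] elements,
whose order is generated by the neighbour relation of the matrix.  Diagonal
entries are free, so each of them but the central one gives its own cell.  For
odd [a] the central entry may lie on either side of [h].  If it is at least [h]
it behaves as one more cell, bounded weakly by its neighbour; if it is below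
[h], then [h - 1] minus it is a value bounded strictly.  Hence [S_count a h] is
one count of functions on cells ([a] even) or the sum of two ([a] odd), see
[S_countE].

These counts fall under Stanley's theory of P-partitions.  Break ties by a linear
order on the cells, and sort the functions according to the linear extension
that they determine: each linear extension contributes one binomial coefficient
[C(h + 1 + c, e_ a)].  So [S_count a] is given by a polynomial of degree [e_ a],
with positive leading coefficient, and the factorial of [e_ a] clears its
denominators.  Reversing the tie-break exchanges weak and strict inequalities
and replaces [c] by [e_ a - 1 - c].  Since [C(-x, p)] is [C(x + p - 1, p)] up to sign, the
value of the polynomial at [-1 - k] is up to sign the number of strict functions
with values below [k] ([ext_count_reciprocity], [horner_sum_binom_neg]).

The poset is graded: every cell other than the central one lies on a chain of
[a - 1] cells.  There is thus no strict function when [k < a - 1], and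
subtracting the rank identifies the strict functions for [k = a - 1 + h] with
the weak ones for [h], the central cell exchanging its two behaviours
([admissible_count_shift]).  Hence [S_a] vanishes at [-1, ..., -(a - 1)], and
[S_a(-a - h)] equals [S_a(h)] up to the sign of [e_ a].  In the variable
[c = h + a/2] the zeros give the binomial factor, and the quotient is even or
odd.  It is odd exactly when [beta_ a = 1]; it then vanishes at [0], which gives
the factor [c], and what is left is even ([factor_exists]).

For the denominator, substitute [c / q] for [c], with [q = 1] for even [a] and
[q = 2] for odd [a].  All the linear factors then become integral after
multiplication by [q].  So a suitable multiple of [s_a(c / q)] becomes integral
when multiplied by a monic integral polynomial, hence is integral itself
([monic_factor_int], [den_bound_int]). *)

(** * Functions sorted by a linear order *)

Lemma card_in_bij (U V : finType) (A : {set U}) (B : {set V})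
    (f : U -> V) (g : V -> U) :
  {in A, forall x, f x \in B} -> {in B, forall y, g y \in A} ->
  {in A, cancel f g} -> {in B, cancel g f} -> #|A| = #|B|.
Proof.
move=> fAB gBA fK gK; apply/eqP; rewrite eqn_leq.
apply/andP; split.
  rewrite -(card_in_imset (can_in_inj fK)).
  by apply/subset_leq_card/subsetP=> _ /imsetP[x xA ->]; apply: fAB.
rewrite -(card_in_imset (can_in_inj gK)).
by apply/subset_leq_card/subsetP=> _ /imsetP[y yB ->]; apply: gBA.
Qed.

Section Partitions.
Variables (T : finType) (x0 : T).

Definition prec (l : rel T) (k : nat) (f : T -> 'I_k) : rel T :=
  fun x y => (f x < f y) || ((f x == f y) && l x y).

Lemma precE l k (f : T -> 'I_k) x y : prec l f x y = (f x + ~~ l x y <= f y).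
Proof. by rewrite /prec -val_eqE /=; case: (l x y); lia. Qed.

(** Along a sequence sorted for [prec l f], the steps [x, y] with [l x y] are those
where [f] may stay constant; the other steps force [f] to increase. *)
Definition ascents (l : rel T) (s : seq T) (n : nat) : nat :=
  \sum_(i < n) l (nth x0 s i) (nth x0 s i.+1).

Lemma ascents0 l s : ascents l s 0 = 0.
Proof. by rewrite /ascents big_ord0. Qed.

Lemma ascentsS l s n :
  ascents l s n.+1 = ascents l s n + l (nth x0 s n) (nth x0 s n.+1).
Proof. by rewrite /ascents big_ord_recr. Qed.

Lemma ascents_le l s m n :
  m <= n -> ascents l s m <= ascents l s n <= ascents l s m + (n - m).
Proof.
move=> /subnK <-; elim: (n - m) => [|d IHd]; first by rewrite add0n; lia.
by rewrite addSn ascentsS; case: (l _ _); lia.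
Qed.

(** Adding to [f] at each position the number of earlier steps where it may stay
constant makes it strictly increasing along [s], and this is a bijection onto
the strictly increasing sequences in a range enlarged by the total number of
such steps. *)
Lemma card_prec_sorted (l : rel T) (s : seq T) (k : nat) :
  perm_eq s (enum T) ->
  #|[set f : {ffun T -> 'I_k} | sorted (prec l f) s]|
    = 'C(k + ascents l s #|T|.-1, #|T|).
Proof.
move=> s_enum.
have size_s : size s = #|T| by rewrite (perm_size s_enum) -cardE.
have mem_s x : x \in s by rewrite (perm_mem s_enum) mem_enum.
have uniq_s : uniq s by rewrite (perm_uniq s_enum) enum_uniq.
have T_gt0 : 0 < #|T| by apply/card_gt0P; exists x0.
set c := ascents l s; set p := #|T| in size_s T_gt0 *.
have c_le m n : m <= n -> c m <= c n <= c m + (n - m) by apply: ascents_le.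
have c0 : c 0 = 0 by exact: ascents0.
have cS i : c i.+1 = c i + l (nth x0 s i) (nth x0 s i.+1) by exact: ascentsS.
case: k => [|k].
  rewrite bin_small; last by have := c_le 0 p.-1; lia.
  by apply: eq_card0 => f; have := ltn_ord (f x0).
rewrite -[RHS]card_ltn_sorted_tuples.
pose up (f : {ffun T -> 'I_k.+1}) : p.-tuple 'I_(k + c p.-1).+1 :=
  [tuple inord (f (nth x0 s i) + c i) | i < p].
pose down (t : p.-tuple 'I_(k + c p.-1).+1) : {ffun T -> 'I_k.+1} :=
  [ffun x => inord (nth ord0 t (index x s) - c (index x s))].
have upE f i : i < p -> nth ord0 (up f) i = f (nth x0 s i) + c i :> nat.
  move=> i_p; rewrite -[i]/(nat_of_ord (Ordinal i_p)) -tnth_nth tnth_mktuple /=.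
  by rewrite inordK //; have := ltn_ord (f (nth x0 s i)); have := c_le i p.-1; lia.
have sortP (t : p.-tuple 'I_(k + c p.-1).+1) :
    reflect (forall i, i.+1 < p -> nth ord0 t i < nth ord0 t i.+1)
            (sorted ltn (map val t)).
  apply: (iffP (sortedP 0)) => H i; have := H i; rewrite size_map size_tuple.
    by move=> Hi i_p; have := Hi i_p; rewrite !(nth_map ord0) ?size_tuple //; lia.
  by move=> Hi i_p; have := Hi i_p; rewrite !(nth_map ord0) ?size_tuple //; lia.
(* A strictly increasing sequence leaves room below and above each of its terms. *)
have low (t : p.-tuple 'I_(k + c p.-1).+1) i :
    sorted ltn (map val t) -> i < p -> i <= nth ord0 t i.
  by move=> /(sortP t) t_lt; elim: i => // i IHi i_p; have := t_lt i i_p; lia.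
have high (t : p.-tuple 'I_(k + c p.-1).+1) i : sorted ltn (map val t) -> i < p ->
    nth ord0 t i + (p.-1 - i) <= k + c p.-1.
  move=> /(sortP t) t_lt i_p; have [d Ed] : exists d, d = p.-1 - i by exists (p.-1 - i).
  elim: d i i_p Ed => [|d IHd] i i_p Ed; first by have := ltn_ord (nth ord0 t i); lia.
  by have := IHd i.+1; have := t_lt i; lia.
have downE (t : p.-tuple 'I_(k + c p.-1).+1) x : sorted ltn (map val t) ->
    down t x = nth ord0 t (index x s) - c (index x s) :> nat.
  have ix : index x s < p by rewrite -size_s index_mem.
  move=> t_s; rewrite ffunE inordK //.
  have := low t _ t_s ix; have := high t _ t_s ix.
  by have := c_le (index x s) p.-1; lia.
apply: (card_in_bij (f := up) (g := down)) => [f|t|f|t]; rewrite !inE.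
- move=> /(sortedP x0) f_s; apply/sortP=> i i_p; rewrite !upE //; last lia.
  have := f_s i; rewrite size_s precE cS.
  by move=> /(_ i_p); case: (l _ _); lia.
- move=> t_s; apply/(sortedP x0) => i; rewrite size_s => i_p.
  rewrite precE !downE // !index_uniq ?size_s //; last lia.
  have := sortP t t_s i i_p; have := low t i t_s; have := c_le 0 i.
  by rewrite cS; case: (l _ _); lia.
- move=> f_s; apply/ffunP=> x; apply: ord_inj; rewrite ffunE.
  have ix : index x s < p by rewrite -size_s index_mem.
  by rewrite upE // nth_index // addnK inord_val.
- move=> t_s; apply: eq_from_tnth => i; apply: ord_inj.
  rewrite !(tnth_nth ord0) upE // downE // index_uniq ?size_s //.
  by have := low t i t_s (ltn_ord i); have := c_le 0 i; lia.
Qed.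

(** * Linear extensions and reciprocity *)

Lemma prec_trans (l : rel T) k (f : T -> 'I_k) :
  transitive l -> transitive (prec l f).
Proof.
move=> l_tr y x z; rewrite /prec -!val_eqE /= => /orP[xy|/andP[/eqP-> lxy]].
  by case/orP=> [yz|/andP[/eqP<- _]]; rewrite ?xy // (ltn_trans xy yz).
by case/orP=> [->//|/andP[-> lyz]]; rewrite (l_tr _ _ _ lxy lyz) orbT.
Qed.

Lemma prec_irr (l : rel T) k (f : T -> 'I_k) :
  irreflexive l -> irreflexive (prec l f).
Proof. by move=> l_irr x; rewrite /prec ltnn l_irr andbF. Qed.

(** These functions are Stanley's (P, omega)-partitions: a relation of [r] is
weak where [l] agrees with it, and strict elsewhere. *)
Definition ext_count (r l : rel T) (k : nat) : nat :=
  #|[set f : {ffun T -> 'I_k} | [forall x, forall y, r x y ==> prec l f x y]]|.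

Definition lin_ext (r : rel T) (s : seq T) : bool :=
  [forall x, forall y, r x y ==> (index x s < index y s)].

Section StrictTotal.
Variable l : rel T.
Hypotheses (l_tr : transitive l) (l_irr : irreflexive l).
Hypothesis l_tot : forall x y, x != y -> l x y || l y x.

Lemma prec_tot k (f : T -> 'I_k) x y : x != y -> prec l f x y || prec l f y x.
Proof.
move=> /l_tot; rewrite /prec -!val_eqE /=.
by case: (ltngtP (f x) (f y)); rewrite ?orbT.
Qed.

(** Since [prec l f] is a strict total order, only one arrangement of [T] is sorted
for it; this is what makes the grouping in [ext_countE] a partition. *)
Lemma prec_sort k (f : T -> 'I_k) :
  exists2 s, s \in permutations (enum T) &
    forall t, t \in permutations (enum T) -> sorted (prec l f) t = (t == s).
Proof.
pose e x y := ~~ prec l f y x.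
have e_tot : total e.
  move=> x y; rewrite /e -negb_and; apply/negP=> /andP[yx xy].
  by have := prec_trans l_tr yx xy; rewrite prec_irr.
have e_prec x y : x != y -> e x y = prec l f x y.
  move=> xy; have := prec_tot f xy; have := e_tot y x; rewrite /e.
  by case: (prec l f x y); case: (prec l f y x).
have e_tr : transitive e.
  move=> y x z; have [<-//|xy] := eqVneq x y; have [<-//|yz] := eqVneq y z.
  rewrite e_prec // (e_prec y) // => {}xy {}yz; have := prec_trans l_tr xy yz.
  have [<-|xz _] := eqVneq x z; first by rewrite prec_irr.
  by rewrite e_prec //; apply: prec_trans xy yz.
have e_sort : sorted (prec l f) (sort e (enum T)).
  rewrite sorted_pairwise; last exact: prec_trans.
  have := sort_sorted e_tot (enum T); rewrite sorted_pairwise // => e_s.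
  have := enum_uniq T; rewrite -(sort_uniq e) uniq_pairwise => ne_s.
  have : pairwise [rel x y | e x y && (x != y)] (sort e (enum T)).
    by rewrite pairwise_relI e_s.
  by apply: sub_pairwise => x y /= /andP[exy xy]; rewrite -e_prec.
exists (sort e (enum T)) => [|t]; rewrite mem_permutations.
  by rewrite perm_sort.
move=> t_enum; apply/idP/eqP => [t_s|->].
  apply: (irr_sorted_eq (prec_trans l_tr (f := f)) (prec_irr f l_irr)) => //.
  by move=> x; rewrite mem_sort (perm_mem t_enum).
exact: e_sort.
Qed.

Lemma sorted_lin_ext r k (f : T -> 'I_k) s :
  s \in permutations (enum T) -> sorted (prec l f) s ->
  [forall x, forall y, r x y ==> prec l f x y] = lin_ext r s.
Proof.
rewrite mem_permutations => s_enum f_s.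
have mem_s x : x \in s by rewrite (perm_mem s_enum) mem_enum.
apply: eq_forallb => x; apply: eq_forallb => y; congr (_ ==> _).
apply/idP/idP => [xy|]; last by apply: sorted_ltn_index => //; apply: prec_trans.
rewrite ltnNge leq_eqVlt; apply/negP=> /orP[/eqP/index_inj|].
  by move=> yx; rewrite yx ?prec_irr // in xy.
have lt_index := sorted_ltn_index (prec_trans l_tr (f := f)) f_s.
move=> /(lt_index _ _ (mem_s _) (mem_s _)) yx.
by have := prec_trans l_tr xy yx; rewrite prec_irr.
Qed.

(** The fundamental lemma of P-partitions: functions are grouped by the unique
sequence that sorts them, which is a linear extension of [r] exactly when the
function is compatible with [r]. *)
Lemma ext_countE r k :
  ext_count r l k =
    \sum_(s <- permutations (enum T) | lin_ext r s)
      'C(k + ascents l s #|T|.-1, #|T|).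
Proof.
transitivity (\sum_(f : {ffun T -> 'I_k})
    \sum_(s <- permutations (enum T)) (lin_ext r s && sorted (prec l f) s : nat)).
  rewrite /ext_count -sum1dep_card big_mkcond; apply: eq_bigr => f _.
  have [s s_enum s_uniq] := prec_sort f.
  rewrite (bigD1_seq s) ?permutations_uniq //= big1_seq => [|t /andP[ts t_enum]].
    have f_s : sorted (prec l f) s by rewrite s_uniq.
    by rewrite addn0 f_s andbT -(sorted_lin_ext r s_enum f_s).
  by rewrite s_uniq // (negPf ts) andbF.
rewrite exchange_big [RHS]big_mkcond /=; apply: eq_big_seq => s.
rewrite mem_permutations => s_enum; case: ifP => _; last by rewrite big1.
by rewrite -card_prec_sorted // -sum1dep_card [RHS]big_mkcond.
Qed.

Lemma ascents_flip s : uniq s -> forall n, n < size s ->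
  ascents (fun x y => l y x) s n = n - ascents l s n.
Proof.
move=> s_uniq; elim=> [|n IHn] n_s; first by rewrite !ascents0.
rewrite !ascentsS IHn; last exact: ltnW.
have /l_tot : nth x0 s n != nth x0 s n.+1.
  by rewrite nth_uniq //; [rewrite neq_ltn ltnSn | exact: ltnW].
have : ~~ (l (nth x0 s n) (nth x0 s n.+1) && l (nth x0 s n.+1) (nth x0 s n)).
  by apply/negP=> /andP[xy yx]; have := l_tr xy yx; rewrite l_irr.
have := ascents_le l s (leq0n n); rewrite !ascents0.
by case: (l _ _); case: (l _ _) => //= ? _ _; lia.
Qed.
End StrictTotal.

(** Reversing the tie-break turns weak inequalities into strict ones and
conversely, while the linear extensions stay the same; in each of them the
steps where [f] may stay constant are exchanged with the others. *)
Lemma ext_count_reciprocity (r l : rel T) :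
    transitive l -> irreflexive l -> (forall x y, x != y -> l x y || l y x) ->
  exists cs : seq nat, {in cs, forall c, c < #|T|} /\ forall k,
    ext_count r l k = \sum_(c <- cs) 'C(k + c, #|T|) /\
    ext_count r (fun x y => l y x) k = \sum_(c <- cs) 'C(k + (#|T|.-1 - c), #|T|).
Proof.
move=> l_tr l_irr l_tot.
have T_gt0 : 0 < #|T| by apply/card_gt0P; exists x0.
have f_tr : transitive (fun x y => l y x).
  by move=> y x z xy yz; apply: l_tr yz xy.
exists [seq ascents l s #|T|.-1 | s <- permutations (enum T) & lin_ext r s].
split=> [_ /mapP[s _ ->]|k].
  by have := ascents_le l s (leq0n #|T|.-1); rewrite !ascents0; lia.
rewrite !big_map !big_filter !ext_countE //; last first.
  by move=> x y xy; apply: l_tot; rewrite eq_sym.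
split=> //.
rewrite -big_filter -[RHS]big_filter; apply: eq_big_seq => s.
rewrite mem_filter mem_permutations => /andP[_ s_enum].
rewrite ascents_flip ?(perm_uniq s_enum) ?enum_uniq //.
by rewrite (perm_size s_enum) -cardE prednK.
Qed.

End Partitions.

(** * The poset of cells *)

Section Cells.
Variable a : nat.

(** Positions with [i <= j] that lie above the antidiagonal, together with the
central one if [a] is odd.  The boolean [x.1.1] selects, for a diagonal position
[(i, i)], the mirror entry [(a - 1 - i, a - 1 - i)], which the antidiagonal
symmetry does not determine.  Measured from [h], it has the same bounds as the
entry at [(i, i)], because its neighbours are the mirror images of those of
[(i, i)]. *)
Definition cell_dom (x : bool * 'I_a * 'I_a) : bool :=
  [&& x.1.2 <= x.2,
      (x.1.2 + x.2 < a.-1) || (x.1.2 == x.2) && (x.1.2 + x.2 == a.-1) &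
      x.1.1 ==> (x.1.2 == x.2) && (x.1.2 + x.2 < a.-1)].

Definition cell := {x : bool * 'I_a * 'I_a | cell_dom x}.

Definition cell_side (x : cell) : bool := (val x).1.1.
Definition cell_row (x : cell) : nat := (val x).1.2.
Definition cell_col (x : cell) : nat := (val x).2.
Definition middle (x : cell) : bool := cell_row x + cell_col x == a.-1.

Definition covers (y x : cell) : bool :=
  ((cell_row y == cell_row x) && (cell_col y == (cell_col x).+1)) ||
  ((cell_row y == (cell_row x).+1) && (cell_col y == cell_col x)).

(** A relation [f y <= f x] is made strict either by [e], for the central cell
only, or by [b], which exchanges weak and strict relations everywhere. *)
Definition admissible (e b : bool) (k : nat) (f : cell -> 'I_k) : bool :=
  [forall y, forall x, covers y x ==> (f y + ((e && middle y) (+) b) <= f x)].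

Definition admissible_count (e b : bool) (k : nat) : nat :=
  #|[set f : {ffun cell -> 'I_k} | admissible e b f]|.

Lemma cellP x :
  [/\ cell_row x <= cell_col x, cell_col x < a,
      cell_row x + cell_col x < a.-1 \/
        cell_row x = cell_col x /\ cell_row x + cell_col x = a.-1 &
      cell_side x -> cell_row x = cell_col x /\ cell_row x + cell_col x < a.-1].
Proof.
rewrite /cell_row /cell_col /cell_side; case: x => [[[s i] j] /= /and3P[/= ij dom sd]].
split=> //; first by case/orP: dom => [->|/andP[/eqP-> /eqP->]]; auto.
by move=> s1; move: sd; rewrite s1 /= => /andP[/eqP-> ->].
Qed.

Lemma cell_ex (s : bool) i j :
    i <= j -> i + j < a.-1 \/ i = j /\ i + j = a.-1 -> j < a ->
    (s -> i = j /\ i + j < a.-1) ->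
  exists x, [/\ cell_side x = s, cell_row x = i & cell_col x = j].
Proof.
move=> ij dom ja sd; have ia : i < a by lia.
have x_dom : cell_dom (s, Ordinal ia, Ordinal ja).
  rewrite /cell_dom /= ij -val_eqE /=.
  case: s sd => /= [/(_ isT)[-> ->]|_]; first by rewrite eqxx.
  by rewrite andbT; case: dom => [->//|[-> ->]]; rewrite !eqxx orbT.
by exists (Sub _ x_dom); rewrite /cell_side /cell_row /cell_col SubK.
Qed.

Lemma cell_inj x y :
  cell_side x = cell_side y -> cell_row x = cell_row y ->
  cell_col x = cell_col y -> x = y.
Proof.
rewrite /cell_side /cell_row /cell_col; case: x => [[[s i] j] Hx]; case: y => [[[t u] v] Hy] /=.
by move=> st /ord_inj iu /ord_inj jv; apply: val_inj; rewrite /= st iu jv.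
Qed.

Lemma admissibleP e b k (f : cell -> 'I_k) :
  reflect (forall y x, covers y x -> f y + ((e && middle y) (+) b) <= f x)
          (admissible e b f).
Proof.
apply: (iffP forallP) => H y; first by move=> x; move/forallP: (H y) => /(_ x)/implyP.
by apply/forallP=> x; apply/implyP/H.
Qed.

(** The labels decrease from the top of the poset to the bottom, so that ties are
allowed along [covers], except that the central cell gets the largest label
when its relation is to be strict. *)
Definition height (e : bool) (x : cell) : nat :=
  if e && middle x then a.+1 else a - (cell_row x + cell_col x).

Definition label (e : bool) (x : cell) : nat :=
  height e x * #|{: cell}| + enum_rank x.

Lemma label_lt e y x : height e y < height e x -> label e y < label e x.
Proof.
move=> lt_h; apply: leq_trans (leq_addr _ _).
apply: leq_trans (_ : (height e y).+1 * #|{: cell}| <= _).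
  by rewrite mulSnr ltn_add2l ltn_ord.
by rewrite leq_mul2r lt_h orbT.
Qed.

Lemma label_inj e : injective (label e).
Proof.
move=> x y; have [hlt|hgt|heq] := ltngtP (height e x) (height e y).
- by have := label_lt hlt; lia.
- by have := label_lt hgt; lia.
by rewrite /label heq => /addnI/ord_inj/enum_rank_inj.
Qed.

Lemma label_covers e y x : covers y x ->
  (label e y < label e x = ~~ (e && middle y)) *
  (label e x < label e y = e && middle y).
Proof.
move=> yx; have [? ? hx _] := cellP x; have [? ? hy _] := cellP y.
have mid_x : middle x = false by move: yx; rewrite /covers /middle; lia.
have [y_mid|y_nmid] := boolP (e && middle y).
  have xy : label e x < label e y.
    by apply: label_lt; rewrite /height y_mid mid_x andbF ltnS leq_subr.
  by rewrite xy ltnNge ltnW.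
have lt_yx : label e y < label e x.
  apply: label_lt; rewrite /height (negPf y_nmid) mid_x andbF.
  by move: yx; rewrite /covers; lia.
by rewrite lt_yx ltnNge ltnW.
Qed.

(** By [label_covers], the labels disagree with [covers] exactly where [e] makes the
relation strict, and the effect of [b] is to reverse all the labels. *)
Lemma admissible_countE e k (l := fun x y => label e x < label e y) :
  (admissible_count e false k = ext_count covers l k) *
  (admissible_count e true k = ext_count covers (fun x y => l y x) k).
Proof.
have eq_adm b (l' : rel cell) :
    (forall y x, covers y x -> l' y x = ~~ ((e && middle y) (+) b)) ->
  admissible_count e b k = ext_count covers l' k.
  move=> l'E; apply: eq_card => f; rewrite !inE; apply: eq_forallb => y.
  apply: eq_forallb => x; apply: implyb_id2l => yx.
  by rewrite precE l'E // negbK.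
by split; apply: eq_adm => y x yx; rewrite /l !(label_covers e yx) ?addbF ?addbT ?negbK.
Qed.

End Cells.

(** * Exchanging weak and strict functions *)

Section Shift.
Variable a : nat.
Hypothesis a_ge2 : 2 <= a.

(** The distance to the bottom rank [a - 2]; on the central cell, which sits one
rank lower, the truncated subtraction gives [0]. *)
Definition corank (x : cell a) : nat := a.-2 - (cell_row x + cell_col x).

Lemma cell_below (x : cell a) : cell_row x + cell_col x < a.-2 ->
  exists2 y, covers y x & cell_row y + cell_col y = (cell_row x + cell_col x).+1.
Proof.
move=> x_lt; have [ij ja _ _] := cellP x.
have [|||//|y [_ yr yc]] := @cell_ex a false (cell_row x) (cell_col x).+1; try lia.
by exists y; rewrite /covers yr yc ?eqxx // addnS.
Qed.

Lemma cell_above (x : cell a) : 0 < cell_row x + cell_col x ->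
  exists2 y, covers x y & cell_row x + cell_col x = (cell_row y + cell_col y).+1.
Proof.
move=> x_gt0; have [ij ja dom _] := cellP x.
have [ij_lt|ij_eq] := ltnP (cell_row x) (cell_col x).
  have [|||//|y [_ yr yc]] := @cell_ex a false (cell_row x) (cell_col x).-1; try lia.
  by exists y; rewrite /covers yr yc; lia.
have [|||//|y [_ yr yc]] := @cell_ex a false (cell_row x).-1 (cell_col x); try lia.
by exists y; rewrite /covers yr yc; lia.
Qed.

Lemma covers_rank (y x : cell a) : covers y x ->
  cell_row y + cell_col y = (cell_row x + cell_col x).+1 /\
  cell_row x + cell_col x <= a.-2.
Proof. by have [_ _ hy _] := cellP y; rewrite /covers; lia. Qed.

(** Below any cell there is a chain reaching the bottom rank, and a strict
function decreases along it. *)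
Lemma strict_ge e k (f : cell a -> 'I_k) x : admissible e true f -> corank x <= f x.
Proof.
move=> /admissibleP f_ok; rewrite /corank; have [n] := ubnP (a.-2 - (cell_row x + cell_col x)).
elim: n x => // n IHn x x_n; case: (ltnP (cell_row x + cell_col x) a.-2) => [x_lt|]; last lia.
have [y yx ry] := cell_below x_lt; have := f_ok y x yx; have := IHn y.
have -> : middle y = false by rewrite /middle; lia.
by rewrite andbF /=; lia.
Qed.

(** Dually, a chain leads from the top cell down to any cell. *)
Lemma strict_le e h (f : cell a -> 'I_(a.-2 + h).+1) x :
  admissible e true f -> f x <= h + corank x.
Proof.
move=> /admissibleP f_ok; rewrite /corank; have [n] := ubnP (cell_row x + cell_col x).
elim: n x => // n IHn x x_n; case: (posnP (cell_row x + cell_col x)) => [->|x_gt0].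
  by have := ltn_ord (f x); lia.
have [y xy rx] := cell_above x_gt0; have := f_ok x y xy; have := IHn y.
have [_ _ hx _] := cellP x.
by rewrite /middle rx; case: eqP; case: e f_ok => /=; lia.
Qed.

(** Adding the corank turns weak relations into strict ones between the ranks
[0, ..., a - 2].  The corank does not change between rank [a - 2] and the central
cell, so that there the relation stays as it is; as [b] reverses the meaning of
[e] at the central cell, [e] becomes [~~ e]. *)
Lemma admissible_count_shift e h :
  admissible_count a e true (a.-1 + h) = admissible_count a (~~ e) false h.+1.
Proof.
have -> : a.-1 + h = (a.-2 + h).+1 by lia.
pose up (f : {ffun cell a -> 'I_h.+1}) : {ffun cell a -> 'I_(a.-2 + h).+1} :=
  [ffun x => inord (f x + corank x)].
pose down (g : {ffun cell a -> 'I_(a.-2 + h).+1}) : {ffun cell a -> 'I_h.+1} :=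
  [ffun x => inord (g x - corank x)].
have upE f x : up f x = f x + corank x :> nat.
  by rewrite ffunE inordK // /corank; have := ltn_ord (f x); lia.
have downE (g : {ffun cell a -> 'I_(a.-2 + h).+1}) x :
    admissible e true g -> down g x = g x - corank x :> nat.
  move=> g_ok; rewrite ffunE inordK //.
  by have := strict_ge x g_ok; have := strict_le x g_ok; lia.
apply/esym/(card_in_bij (f := up) (g := down)) => [f|g|f|g]; rewrite !inE.
- move=> /admissibleP f_ok; apply/admissibleP=> y x yx; rewrite !upE.
  have := f_ok y x yx; have := covers_rank yx; rewrite /corank /middle.
  by move=> [-> ?]; case: eqP; case: (e) => /=; lia.
- move=> g_ok; apply/admissibleP=> y x yx; rewrite !downE //.
  have := strict_ge x g_ok; have := strict_ge y g_ok.
  have /admissibleP/(_ y x yx) := g_ok; have := covers_rank yx; rewrite /corank /middle.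
  by move=> [-> ?]; case: eqP; case: (e) => /=; lia.
- by move=> f_ok; apply/ffunP=> x; apply: ord_inj; rewrite ffunE upE addnK inord_val.
- move=> g_ok; apply/ffunP=> x; apply: ord_inj; rewrite upE downE //.
  by rewrite subnK // (strict_ge x g_ok).
Qed.

(** The chain from the top cell to the bottom rank needs [a - 1] distinct values. *)
Lemma admissible_count_small e k : k < a.-1 -> admissible_count a e true k = 0.
Proof.
move=> k_lt; apply: eq_card0 => f; rewrite inE; apply/negP=> f_ok.
have [||||x [_ xr xc]] := @cell_ex a false 0 0; try lia.
by have := leq_ltn_trans (strict_ge x f_ok) (ltn_ord (f x)); rewrite /corank xr xc; lia.
Qed.

Lemma admissible_count_even e b k :
  ~~ odd a -> admissible_count a e b k = admissible_count a false b k.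
Proof.
move=> a_even; apply: eq_card => f; rewrite !inE /admissible.
apply: eq_forallb => y; apply: eq_forallb => x.
suff -> : middle y = false by rewrite andbF.
by have [_ _ hy _] := cellP y; rewrite /middle; lia.
Qed.

Lemma sum_interval n u v : \sum_(j < n) (u <= j < v : nat) = minn n v - u.
Proof.
by elim: n => [|n IHn]; rewrite ?big_ord0 ?big_ord_recr /= ?IHn; lia.
Qed.

Lemma sum_subn_double n : \sum_(i < n) (n - i.*2) = e_ n.
Proof.
have [m] := ubnP n; elim: m n => // m IHm [|[|n]] n_m.
- by rewrite big_ord0.
- by rewrite big_ord1.
rewrite big_ord_recl big_ord_recr /=.
under eq_bigr => i _ do rewrite /bump /= doubleS !subSS.
rewrite IHm; last by lia.
rewrite /e_ /bump /=.
rewrite (_ : (n.+2 + 1) ^ 2 = n.+2 * 4 + (n + 1) ^ 2) ?divnMDl //; first lia.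
by rewrite -!mulnn; lia.
Qed.

Lemma card_cell : #|{: cell a}| = e_ a.
Proof.
rewrite card_sig -sum1_card big_mkcond /= -sum_subn_double.
rewrite -(pair_bigA _ (fun si j => if cell_dom (si, j) then 1 else 0)) /=.
rewrite -(pair_bigA _ (fun s i => \sum_j if cell_dom (s, i, j) then 1 else 0)) /=.
rewrite exchange_big; apply: eq_bigr => i _; rewrite big_bool -big_split /=.
(* In row [i], the cells of each of the two sides form an interval of columns. *)
transitivity (\sum_(j < a) ((i <= j < i + (i.*2 < a.-1)) +
    (i <= j < if i.*2 == a.-1 then i.+1 else a.-1 - i))).
  apply: eq_bigr => j _; rewrite /cell_dom /= -val_eqE /=.
  set b := (X in (if X then _ else _) + _); set c := (X in _ + (if X then _ else _)).
  rewrite -[if b then 1 else 0]/(b : nat) -[if c then 1 else 0]/(c : nat) /b /c.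
  by case: (ltngtP i.*2 a.-1) => ?; case: (ltngtP i j) => ?; lia.
rewrite big_split !sum_interval /=; have := ltn_ord i.
by case: (ltngtP i.*2 a.-1) => ?; lia.
Qed.
End Shift.

(** * Plane partitions as functions on cells *)

Section Patterns.
Variables a h : nat.
Hypothesis a_ge2 : 2 <= a.

(** Entries at natural number positions: mirror images and neighbours are then
plain arithmetic, at the price of the value [0] outside the matrix. *)
Definition entry (p : 'M['I_(2 * h).+1]_a) (i j : nat) : nat :=
  if (insub i, insub j) is (Some i', Some j') then p i' j' else 0.

Lemma entryE p (i j : 'I_a) : entry p i j = p i j.
Proof. by rewrite /entry !valK. Qed.

Lemma entry_le p i j : entry p i j <= 2 * h.
Proof.
rewrite /entry; case: insub => // i'; case: insub => // j'.
by rewrite -ltnS ltn_ord.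
Qed.

(** Column monotonicity follows from row monotonicity by the symmetry of the
matrix. *)
Lemma S_setP (p : 'M['I_(2 * h).+1]_a) :
  reflect
    [/\ forall i j, i < a -> j.+1 < a -> entry p i j.+1 <= entry p i j,
        forall i j, i < a -> j < a -> entry p i j = entry p j i &
        forall i j, i < a -> j < a -> i <> j ->
          entry p i j + entry p (a.-1 - j) (a.-1 - i) = 2 * h]
    (p \in S_set a h).
Proof.
have entryO i j (ia : i < a) (ja : j < a) :
    entry p i j = p (Ordinal ia) (Ordinal ja) by rewrite -entryE.
rewrite inE; apply: (iffP and3P).
  case=> /andP[_ /forallP p_row] /forallP p_tau /forallP p_sym; split.
  - move=> i j ia ja; rewrite !entryO ?(ltnW ja) // => ja'.
    have := p_row (Ordinal ia) => /forallP/(_ (Ordinal ja'))/forallP/(_ (Ordinal ja)).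
    by rewrite /= eqxx.
  - move=> i j ia ja; rewrite !entryO.
    by have /forallP/(_ (Ordinal ja))/eqP -> := p_sym (Ordinal ia).
  move=> i j ia ja ij.
  have /forallP/(_ (Ordinal ja)) := p_tau (Ordinal ia).
  rewrite -val_eqE /= (introN eqP ij) /= -!entryE /= => /eqP <-.
  by congr (_ + entry p _ _); lia.
case=> p_row p_sym p_tau; split; first (apply/andP; split).
- apply/forallP=> i; apply/forallP=> i'; apply/forallP=> j; apply/implyP=> /eqP ii'.
  rewrite -!entryE p_sym // (p_sym i) // ii'; apply: p_row => //.
  by rewrite -ii'.
- apply/forallP=> i; apply/forallP=> j; apply/forallP=> j'; apply/implyP=> /eqP jj'.
  by rewrite -!entryE jj'; apply: p_row => //; rewrite -jj'.
- apply/forallP=> i; apply/forallP=> j; apply/implyP; rewrite -val_eqE /= => ij.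
  rewrite -!entryE /= -(p_tau i j) //; last exact/eqP.
  by apply/eqP; congr (_ + entry p _ _); lia.
by apply/forallP=> i; apply/forallP=> j; rewrite -val_eqE /= -!entryE p_sym.
Qed.

Lemma entry_matrix (u : nat -> nat -> nat) i j :
    i < a -> j < a -> u i j <= 2 * h ->
  entry (\matrix_(i, j) inord (u i j)) i j = u i j.
Proof.
move=> ia ja u_le; rewrite -[i]/(val (Ordinal ia)) -[j]/(val (Ordinal ja)).
by rewrite entryE mxE inordK.
Qed.

Lemma entry_inj p q :
  (forall i j, i < a -> j < a -> entry p i j = entry q i j) -> p = q.
Proof.
by move=> pq; apply/matrixP=> i j; apply: ord_inj; rewrite -!entryE; apply: pq.
Qed.

Section FromCells.
Variables (e : bool) (f : {ffun cell a -> 'I_h.+1}).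

Definition cell_val (s : bool) (i j : nat) : nat :=
  if [pick x | [&& cell_side x == s, cell_row x == i & cell_col x == j]] is Some x
  then f x else 0.

Lemma cell_valE x : cell_val (cell_side x) (cell_row x) (cell_col x) = f x.
Proof.
rewrite /cell_val; case: pickP => [y /and3P[/eqP s /eqP r /eqP c]|/(_ x)].
  by rewrite (cell_inj s r c).
by rewrite !eqxx.
Qed.

Lemma cell_val_le s i j : cell_val s i j <= h.
Proof.
by rewrite /cell_val; case: pickP => // x _; rewrite -ltnS ltn_ord.
Qed.

(** The entry at a position with [i <= j].  Below the antidiagonal the value is
subtracted from [h] at the mirror position; [i == j] then selects the cell of
the mirrored diagonal entry.  At the central position [e] tells whether the
entry is below [h]. *)
Definition upper (i j : nat) : nat :=
  if i + j < a.-1 then h + cell_val false i j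
  else if i + j == a.-1 then
    if i == j then if e then h.-1 - cell_val false i j else h + cell_val false i j
    else h
  else h - cell_val (i == j) (a.-1 - j) (a.-1 - i).

Definition unfold_entry (i j : nat) : nat :=
  if i <= j then upper i j else upper j i.

Definition unfold_cells : 'M['I_(2 * h).+1]_a :=
  \matrix_(i, j) inord (unfold_entry i j).

Lemma upper_le i j : upper i j <= 2 * h.
Proof.
rewrite /upper; have := cell_val_le false i j.
by do !case: ifP => _; lia.
Qed.

Lemma entry_unfold i j : i < a -> j < a ->
  entry unfold_cells i j = unfold_entry i j.
Proof.
move=> ia ja; apply: entry_matrix => //; rewrite /unfold_entry.
by case: ifP => _; apply: upper_le.
Qed.

Hypothesis f_adm : admissible e false f.

Lemma cell_val_mono (s t : bool) i j i' j' :
    (i' = i /\ j' = j.+1) \/ (i' = i.+1 /\ j' = j) ->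
    i <= j -> i + j < a.-1 -> (s -> i = j) ->
    i' <= j' -> i' + j' < a.-1 \/ i' = j' /\ i' + j' = a.-1 ->
    (t -> i' = j' /\ i' + j' < a.-1) ->
  cell_val t i' j' + (e && (i' + j' == a.-1)) <= cell_val s i j.
Proof.
move=> st ij ij_lt s_eq ij' ij_lt' t_eq.
have [|||/s_eq|x [<- xr xc]] := @cell_ex a s i j; [lia..|].
have [|||/t_eq|y [<- yr yc]] := @cell_ex a t i' j'; [lia..|].
rewrite -xr -xc -yr -yc !cell_valE.
have yx : covers y x by rewrite /covers; lia.
by have /admissibleP/(_ y x yx) := f_adm; rewrite addbF.
Qed.

(** Across the antidiagonal the comparison goes through [h].  The central entry
may be below [h]; its right neighbour is then no larger, by the strict relation
between the central cell and the cell above it. *)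
Lemma upper_right i j : i <= j -> j.+1 < a -> upper i j.+1 <= upper i j.
Proof.
move=> ij ja; rewrite /upper.
have le_h := cell_val_le.
have [lt1|gt1|eq1] := ltngtP (i + j) a.-1.
- have [lt2|gt2|eq2] := ltngtP (i + j.+1) a.-1; [|lia|].
    by rewrite leq_add2l; have := @cell_val_mono false false i j i j.+1; lia.
  by case: eqP => ?; lia.
- have -> : (i + j.+1 < a.-1) = false by lia.
  have -> : (i + j.+1 == a.-1) = false by lia.
  have -> : (i == j.+1) = false by lia.
  apply: leq_sub2l.
  have := @cell_val_mono false (i == j) (a.-1 - j.+1) (a.-1 - i) (a.-1 - j) (a.-1 - i).
  lia.
have -> : (i + j.+1 < a.-1) = false by lia.
have -> : (i + j.+1 == a.-1) = false by lia.
have -> : (i == j.+1) = false by lia.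
case: eqP => [ij_eq|_]; last lia.
have := @cell_val_mono false false (a.-1 - j.+1) (a.-1 - i) i j.
have := le_h false (a.-1 - j.+1) (a.-1 - i).
by case: (e); lia.
Qed.

Lemma upper_down i j : i < j -> j < a -> upper i.+1 j <= upper i j.
Proof.
move=> ij ja; rewrite /upper.
have le_h := cell_val_le.
have [lt1|gt1|eq1] := ltngtP (i + j) a.-1.
- have [lt2|gt2|eq2] := ltngtP (i.+1 + j) a.-1; [|lia|].
    by rewrite leq_add2l; have := @cell_val_mono false false i j i.+1 j; lia.
  case: eqP => ij_eq; last lia.
  have := @cell_val_mono false false i j i.+1 j.
  by case: (e); lia.
- have -> : (i.+1 + j < a.-1) = false by lia.
  have -> : (i.+1 + j == a.-1) = false by lia.
  have -> : (i == j) = false by lia.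
  apply: leq_sub2l.
  have := @cell_val_mono (i.+1 == j) false (a.-1 - j) (a.-1 - i.+1) (a.-1 - j) (a.-1 - i).
  lia.
have -> : (i.+1 + j < a.-1) = false by lia.
have -> : (i.+1 + j == a.-1) = false by lia.
have -> : (i == j) = false by lia.
lia.
Qed.

Lemma upper_tau i j : i < j -> j < a ->
  upper i j + upper (a.-1 - j) (a.-1 - i) = 2 * h.
Proof.
move=> ij ja; rewrite /upper.
have -> : (i == j) = false by lia.
have -> : (a.-1 - j == a.-1 - i) = false by lia.
have -> : a.-1 - (a.-1 - i) = i by lia.
have -> : a.-1 - (a.-1 - j) = j by lia.
have := cell_val_le false i j; have := cell_val_le false (a.-1 - j) (a.-1 - i).
case: (ltngtP (i + j) a.-1) => ?;
  by case: (ltngtP (a.-1 - j + (a.-1 - i)) a.-1) => ?; lia.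
Qed.

Lemma unfold_cells_S : unfold_cells \in S_set a h.
Proof.
apply/S_setP; split=> i j ia ja; rewrite ?entry_unfold //; try lia; rewrite /unfold_entry.
- case: (ltngtP i j) => ij.
  + by rewrite (leqW (ltnW ij)); apply: upper_right => //; apply: ltnW.
  + case: (leqP i j.+1) => ij'; last exact: upper_down.
    have -> : i = j.+1 by lia.
    exact: upper_down.
  by rewrite ij leqnSn; apply: upper_right.
- by case: ltngtP => // ->.
have -> : (a.-1 - j <= a.-1 - i) = (i <= j) by lia.
case: (ltngtP i j) => // ij _; first exact: upper_tau.
exact: upper_tau.
Qed.

End FromCells.

Section ToCells.
Variable p : 'M['I_(2 * h).+1]_a.

Definition mid_low : bool := [exists i : 'I_a, (i + i == a.-1) && (p i i < h)].

(** For [p] in [S_set a h] and on a cell, the test [entry p i j < h] can only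
succeed at the central position, by [entry_ge]. *)
Definition fold_val (s : bool) (i j : nat) : nat :=
  if s then h - entry p (a.-1 - i) (a.-1 - i)
  else if entry p i j < h then h.-1 - entry p i j else entry p i j - h.

Definition fold_cells : {ffun cell a -> 'I_h.+1} :=
  [ffun x => inord (fold_val (cell_side x) (cell_row x) (cell_col x))].

Lemma fold_cellsE x :
  fold_cells x = fold_val (cell_side x) (cell_row x) (cell_col x) :> nat.
Proof.
rewrite ffunE inordK // /fold_val ltnS; case: ifP => _; first exact: leq_subr.
have := entry_le p (cell_row x) (cell_col x); case: ltnP; lia.
Qed.

Lemma mid_lowP i : i + i = a.-1 -> mid_low = (entry p i i < h).
Proof.
move=> ii; have ia : i < a by lia.
rewrite -[i]/(val (Ordinal ia)) entryE; apply/existsP/idP => [[j]|p_low].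
  by move=> /andP[/eqP jj]; rewrite (_ : j = Ordinal ia) //; apply: ord_inj => /=; lia.
by exists (Ordinal ia); rewrite /= ii eqxx.
Qed.

Lemma mid_low_odd : mid_low ==> odd a.
Proof. by apply/implyP=> /existsP[i /andP[/eqP ii _]]; lia. Qed.

Hypothesis p_S : p \in S_set a h.

Lemma entry_row i j j' : i < a -> j <= j' -> j' < a -> entry p i j' <= entry p i j.
Proof.
have [p_row _ _] := S_setP p p_S.
move=> ia /subnK <-; elim: (j' - j) => // d IHd ja.
by apply: leq_trans (IHd _); [apply: p_row | apply: ltnW].
Qed.

Lemma entry_col i i' j : j < a -> i <= i' -> i' < a -> entry p i' j <= entry p i j.
Proof.
have [_ p_sym _] := S_setP p p_S.
move=> ja ii i'a; have ia : i < a by lia.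
by rewrite p_sym // (p_sym i) //; apply: entry_row.
Qed.

(** The reflection fixes the antidiagonal, so that twice the entry is [2 * h]. *)
Lemma entry_anti i : i < a -> i + i <> a.-1 -> entry p i (a.-1 - i) = h.
Proof.
have [_ _ p_tau] := S_setP p p_S.
move=> ia ii; have := p_tau i (a.-1 - i) ia.
have -> : a.-1 - (a.-1 - i) = i by lia.
lia.
Qed.

Lemma entry_ge i j : i <= j -> i + j < a.-1 -> h <= entry p i j.
Proof.
move=> ij ij_lt; rewrite -(@entry_anti i); [|lia|lia].
by apply: entry_row; lia.
Qed.

Lemma entry_tau i j : i < a -> j < a -> i <> j ->
  entry p i j + entry p (a.-1 - j) (a.-1 - i) = 2 * h.
Proof. by have [_ _ p_tau] := S_setP p p_S; apply: p_tau. Qed.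

Lemma entry_diag_le i : i + i < a.-1 -> entry p (a.-1 - i) (a.-1 - i) <= h.
Proof.
move=> ii; rewrite -(@entry_anti i); [|lia|lia].
by apply: entry_col; lia.
Qed.

(** A relation that involves a mirrored diagonal entry, or a central entry below
[h], is the reflection of a monotonicity relation on the other side of the
antidiagonal. *)
Lemma fold_admissible : admissible mid_low false fold_cells.
Proof.
apply/admissibleP=> y x yx; rewrite !fold_cellsE addbF.
have [ij ja dom sd] := cellP x; have [ij' ja' dom' sd'] := cellP y.
have [rk rk_le] := covers_rank a_ge2 yx.
rewrite /middle; move: yx rk rk_le; rewrite /covers.
move: (cell_side x) (cell_row x) (cell_col x) (cell_side y) (cell_row y) (cell_col y)
  ij ja dom sd ij' ja' dom' sd' => s i j t i' j' ij ja dom sd ij' ja' dom' sd' yx rk rk_le.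
have x_ge : h <= entry p i j by apply: entry_ge; lia.
case: s sd => [/(_ isT)[ij_eq _]|_].
  (* The upper cell is a mirrored diagonal entry, so the lower one is off the
     diagonal and its own mirror image lies above that entry in the matrix. *)
  have t0 : t = false by case: (t) sd' => // /(_ isT); lia.
  have -> : (i' + j' == a.-1) = false by lia.
  have [-> ->] : i' = i /\ j' = i.+1 by lia.
  have y_ge : h <= entry p i i.+1 by apply: entry_ge; lia.
  have := @entry_tau i i.+1; have := @entry_col (a.-1 - i.+1) (a.-1 - i) (a.-1 - i).
  by rewrite t0 andbF /fold_val [_ < h]ltnNge y_ge /=; lia.
rewrite {2}/fold_val [_ < h]ltnNge x_ge /=.
(* Symmetrically when the lower cell is a mirrored diagonal entry. *)
case: t sd' => [/(_ isT)[ij_eq' lt']|_].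
  have -> : (i' + j' == a.-1) = false by lia.
  have [-> ->] : i = i'.-1 /\ j = i' by lia.
  have := @entry_tau i'.-1 i'; have := @entry_row (a.-1 - i') (a.-1 - i') (a.-1 - i'.-1).
  by rewrite andbF /fold_val; lia.
have le_yx : entry p i' j' <= entry p i j.
  by apply: leq_trans (entry_row _ _ _) (entry_col _ _ _); lia.
case: eqP dom' => [mid_y [|[ij_eq' _]]|_ [|[]]] //; first by rewrite mid_y ltnn.
  have [i_eq j_eq] : i = i'.-1 /\ j = i' by lia.
  rewrite (@mid_lowP i') //; last lia.
  have := @entry_tau i'.-1 i'; have := @entry_row (a.-1 - i') (a.-1 - i') (a.-1 - i'.-1).
  have -> : a.-1 - i' = i' by lia.
  rewrite /fold_val -ij_eq'; rewrite -ij_eq' i_eq j_eq in le_yx x_ge *.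
  by case: (ltnP (entry p i' i') h); lia.
move=> lt'; have y_ge : h <= entry p i' j' by apply: entry_ge.
by rewrite /fold_val [_ < h]ltnNge y_ge andbF /=; lia.
Qed.

Lemma cell_val_fold (s : bool) i j :
    i <= j -> i + j < a.-1 \/ i = j /\ i + j = a.-1 ->
    (s -> i = j /\ i + j < a.-1) ->
  cell_val fold_cells s i j = fold_val s i j.
Proof.
move=> ij dom sd; have [|||//|x [<- <- <-]] := @cell_ex a s i j; try lia.
by rewrite cell_valE fold_cellsE.
Qed.

Lemma unfold_fold : unfold_cells mid_low fold_cells = p.
Proof.
have [_ p_sym _] := S_setP p p_S.
apply: entry_inj => i j ia ja; rewrite entry_unfold // /unfold_entry.
wlog ij : i j ia ja / i <= j => [wl|].
  case: (leqP i j) => ij; first by have := wl i j ia ja ij; rewrite ij.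
  by have := wl j i ja ia (ltnW ij); rewrite (ltnW ij) => ->; apply: p_sym.
rewrite ij /upper; case: (ltngtP (i + j) a.-1) => ij_rk.
- have := entry_ge ij ij_rk; rewrite cell_val_fold //; last by left.
  by rewrite /fold_val; case: ltnP; lia.
- rewrite cell_val_fold; [|lia|lia|by move=> /eqP; lia].
  rewrite /fold_val; case: eqP => ij_eq.
    have jj : a.-1 - (a.-1 - j) = j by lia.
    by have := @entry_diag_le (a.-1 - j); rewrite jj ij_eq; lia.
  have := @entry_tau i j; have := @entry_ge (a.-1 - j) (a.-1 - i).
  by case: (ltnP (entry p (a.-1 - j) (a.-1 - i)) h); lia.
case: eqP => [ij_eq|ij_ne].
  rewrite -ij_eq in ij_rk *; rewrite (mid_lowP ij_rk) cell_val_fold //; last by right.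
  by rewrite /fold_val; case: ltnP; lia.
have -> : j = a.-1 - i by lia.
by rewrite entry_anti //; lia.
Qed.

End ToCells.

Section Unfolded.
Variables (e : bool) (f : {ffun cell a -> 'I_h.+1}).
Hypotheses (e_odd : e ==> odd a) (f_adm : admissible e false f).

Lemma mid_val i : e -> i + i = a.-1 -> cell_val f false i i < h.
Proof.
move=> e1 ii.
have := @cell_val_mono e f f_adm false false i.-1 i i i; have := cell_val_le f false i.-1 i.
by rewrite e1 ii eqxx; lia.
Qed.

Lemma mid_low_unfold : mid_low (unfold_cells e f) = e.
Proof.
case: (boolP (odd a)) => a_odd; last first.
  have := mid_low_odd (unfold_cells e f); have := e_odd.
  by rewrite (negPf a_odd) !implybF => /negPf-> /negPf->.
have ii : a./2 + a./2 = a.-1 by lia.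
rewrite (mid_lowP _ ii) entry_unfold; [|lia|lia].
rewrite /unfold_entry leqnn /upper ii ltnn !eqxx.
by have := @mid_val a./2; case: (e) => [/(_ isT ii)|_]; lia.
Qed.

Lemma fold_unfold : fold_cells (unfold_cells e f) = f.
Proof.
apply/ffunP=> x; apply: ord_inj; rewrite fold_cellsE -cell_valE.
have [] := cellP x.
move: (cell_side x) (cell_row x) (cell_col x) => s i j ij ja dom sd.
rewrite /fold_val; case: s sd => [/(_ isT)[<- ii]|_].
  rewrite entry_unfold; [|lia|lia].
  rewrite /unfold_entry leqnn /upper.
  have -> : (a.-1 - i + (a.-1 - i) < a.-1) = false by lia.
  have -> : (a.-1 - i + (a.-1 - i) == a.-1) = false by lia.
  have -> : a.-1 - (a.-1 - i) = i by lia.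
  by rewrite eqxx; have := cell_val_le f true i i; lia.
rewrite entry_unfold //; last lia.
rewrite /unfold_entry ij /upper; case: dom => [lt_ij|[<- ii]].
  by rewrite lt_ij; case: ltnP; lia.
rewrite ii ltnn !eqxx; have := @mid_val i; have := cell_val_le f false i i.
set v := cell_val f false i i.
case: (e) => [_ /(_ isT ii)|_ _]; first by case: (ltnP (h.-1 - v) h); lia.
by case: (ltnP (h + v) h); lia.
Qed.
End Unfolded.

(** For odd [a] the two values of [e] are the two positions of the central entry
relative to [h]. *)
Lemma S_countE :
  S_count a h = \sum_(e : bool | e ==> odd a) admissible_count a e false h.+1.
Proof.
pose B := [set ef : bool * {ffun cell a -> 'I_h.+1} |
  (ef.1 ==> odd a) && admissible ef.1 false ef.2].
transitivity #|B|; last first.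
  rewrite -sum1dep_card.
  rewrite -(pair_big_dep (fun e => e ==> odd a)
    (fun e (f : {ffun cell a -> 'I_h.+1}) => admissible e false f) (fun _ _ => 1)).
  by apply: eq_bigr => e _; rewrite sum1dep_card.
apply: (card_in_bij (f := fun p => (mid_low p, fold_cells p))
                    (g := fun ef => unfold_cells ef.1 ef.2)).
- by move=> p p_S; rewrite inE /= mid_low_odd fold_admissible.
- by move=> [e f]; rewrite inE => /andP[/= _ f_adm] /=; apply: unfold_cells_S.
- by move=> p p_S /=; apply: unfold_fold.
move=> [e f]; rewrite inE => /andP[/= e_odd f_adm].
by rewrite mid_low_unfold // fold_unfold.
Qed.
End Patterns.

(** * The counting function as a sum of binomial coefficients *)

(** The combinatorial content of the theorem: the same list [cs] describes the
partitions and the strict functions, and the latter are either absent or again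
counted by [S_count]. *)
Lemma S_count_binomials a : 2 <= a ->
  exists cs : seq nat, [/\ cs != [::], {in cs, forall c, c < e_ a},
    forall h, S_count a h = \sum_(c <- cs) 'C(h.+1 + c, e_ a),
    forall k, k < a.-1 -> \sum_(c <- cs) 'C(k + ((e_ a).-1 - c), e_ a) = 0 &
    forall h, \sum_(c <- cs) 'C(a.-1 + h + ((e_ a).-1 - c), e_ a) = S_count a h].
Proof.
move=> a_ge2.
have [||||x0 _] := @cell_ex a false 0 0; try lia.
have rec e : exists cs : seq nat, {in cs, forall c, c < e_ a} /\ forall k,
    admissible_count a e false k = \sum_(c <- cs) 'C(k + c, e_ a) /\
    admissible_count a e true k = \sum_(c <- cs) 'C(k + ((e_ a).-1 - c), e_ a).
  have [|||cs [cs_lt csE]] := @ext_count_reciprocity _ x0 (@covers a)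
      (fun x y => label e x < label e y).
  - by move=> y x z; apply: ltn_trans.
  - by move=> x; apply: ltnn.
  - move=> x y xy; rewrite -neq_ltn; apply: contra_neq xy; exact: label_inj.
  exists cs; rewrite -card_cell //; split=> // k.
  by have [E1 E2] := csE k; rewrite !admissible_countE E1 E2.
have [c0 [c0_lt c0E]] := rec false; have [c1 [c1_lt c1E]] := rec true.
(* The zero function is admissible when no relation is strict. *)
have c0_n0 : c0 != [::].
  apply/eqP=> c0_nil; have : 0 < admissible_count a false false 1.
    apply/card_gt0P; exists [ffun=> ord0]; rewrite inE; apply/admissibleP=> y x _.
    by rewrite !ffunE.
  by rewrite (proj1 (c0E 1)) c0_nil big_nil.
pose cs := if odd a then c0 ++ c1 else c0.
have csE h : S_count a h = \sum_(c <- cs) 'C(h.+1 + c, e_ a).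
  rewrite S_countE // /cs big_mkcond big_bool /=.
  case: (odd a) => /=; rewrite ?big_cat /= -!(proj1 (c0E _)) -?(proj1 (c1E _)); lia.
have csE' k : \sum_(c <- cs) 'C(k + ((e_ a).-1 - c), e_ a) =
    admissible_count a false true k + (if odd a then admissible_count a true true k else 0).
  rewrite /cs; case: (odd a); rewrite ?big_cat /= -!(proj2 (c0E _)) -?(proj2 (c1E _)); lia.
exists cs; split=> //.
- rewrite /cs; case: ifP => // _.
  by rewrite -size_eq0 size_cat addn_eq0 negb_and size_eq0 c0_n0.
- rewrite /cs; case: ifP => // _ c; rewrite mem_cat => /orP[/c0_lt|/c1_lt] //.
- by move=> k k_lt; rewrite csE' !admissible_count_small //; case: ifP.
move=> h; rewrite csE' S_countE // big_mkcond big_bool /=.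
case: (boolP (odd a)) => a_odd /=; rewrite !admissible_count_shift //=.
by rewrite admissible_count_even // addn0.
Qed.

Import Order.TTheory GRing.Theory Num.Theory.
Local Open Scope ring_scope.

(** * Sums of binomial polynomials *)

Lemma poly_eq_nat (p q : {poly rat}) :
  (forall n : nat, p.[n%:R] = q.[n%:R]) -> p = q.
Proof.
move=> pq; apply/eqP; rewrite -subr_eq0; apply/negP=> /negP pq_n0.
have := @max_poly_roots _ (p - q) [seq n%:R | n <- iota 0 (size (p - q))] pq_n0.
rewrite size_map size_iota ltnn => /(_ _ _)/negP; apply; rewrite ?not_false_is_true //.
  by apply/allP=> _ /mapP[n _ ->]; rewrite rootE !hornerE pq subrr.
by rewrite map_inj_uniq ?iota_uniq // => m n /eqP; rewrite eqr_nat => /eqP.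
Qed.

Lemma prod_nat_sub n k : \prod_(i < k) (n%:R - i%:R) = (n ^_ k)%:R :> rat.
Proof.
elim: k => [|k IHk]; first by rewrite big_ord0.
rewrite big_ord_recr /= {}IHk ffactnSr natrM.
case: (leqP k n) => [le_kn|lt_nk]; first by rewrite natrB.
by rewrite ffact_small // !mul0r.
Qed.

Lemma horner_binom_poly (q : {poly rat}) k x :
  (binom_poly q k).[x] = k`!%:R^-1 * \prod_(i < k) (q.[x] - i%:R).
Proof.
rewrite hornerZ horner_prod; congr (_ * _).
by apply: eq_bigr => i _; rewrite !hornerE.
Qed.

Lemma fact_neq0 k : k`!%:R != 0 :> rat.
Proof. by rewrite pnatr_eq0 -lt0n fact_gt0. Qed.

Lemma horner_binom_nat (q : {poly rat}) k x n :
  q.[x] = n%:R -> (binom_poly q k).[x] = 'C(n, k)%:R.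
Proof.
move=> qx; rewrite horner_binom_poly qx prod_nat_sub -bin_ffact natrM.
by rewrite mulrC mulfK // fact_neq0.
Qed.

(** Reciprocity of binomial coefficients under [x -> k - 1 - x]. *)
Lemma horner_binom_neg (q : {poly rat}) k x n :
  q.[x] = k%:R - 1 - n%:R -> (binom_poly q k).[x] = (-1) ^+ k * 'C(n, k)%:R.
Proof.
move=> qx; rewrite horner_binom_poly qx.
have -> : \prod_(i < k) (k%:R - 1 - n%:R - i%:R) = (-1) ^+ k * (n ^_ k)%:R :> rat.
  rewrite -prod_nat_sub (reindex_inj rev_ord_inj) /=.
  rewrite -[X in (-1) ^+ X](card_ord k) -prodrN; apply: eq_bigr => i _.
  by rewrite natrB // -natr1; ring.
by rewrite -bin_ffact natrM; field; rewrite fact_neq0.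
Qed.

Lemma prod_X_sub (c : rat) k :
  \prod_(i < k) ('X + c%:P - i%:R%:P) = \prod_(i < k) ('X - (i%:R - c)%:P).
Proof. by apply: eq_bigr => i _; rewrite polyCB opprB addrA addrAC. Qed.

Lemma binom_polyE (c : rat) k :
  binom_poly ('X + c%:P) k = k`!%:R^-1 *: \prod_(i < k) ('X - (i%:R - c)%:P).
Proof. by rewrite -prod_X_sub. Qed.

(** The shift by [c.+1] and not by [c]: functions with values in [0, h] take
[h.+1] values. *)
Definition sum_binom (cs : seq nat) (k : nat) : {poly rat} :=
  \sum_(c <- cs) binom_poly ('X + c.+1%:R%:P) k.

Lemma horner_sum_binom cs k n :
  (sum_binom cs k).[n%:R] = (\sum_(c <- cs) 'C(n.+1 + c, k))%N%:R.
Proof.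
rewrite horner_sum natr_sum; apply: eq_bigr => c _; apply: horner_binom_nat.
by rewrite !hornerE -natrD addSnnS.
Qed.

Lemma horner_sum_binom_neg cs k n : {in cs, forall c, (c < k)%N} ->
  (sum_binom cs k).[- 1 - n%:R] =
  (-1) ^+ k * (\sum_(c <- cs) 'C(n + (k.-1 - c), k))%N%:R.
Proof.
move=> cs_lt; rewrite horner_sum natr_sum mulr_sumr.
rewrite big_seq [RHS]big_seq; apply: eq_bigr => c /cs_lt c_lt.
have k_gt0 : (0 < k)%N by exact: leq_ltn_trans c_lt.
have c_le : (c <= k - 1)%N by rewrite subn1 -ltnS prednK.
apply: horner_binom_neg; rewrite !hornerE natrD -subn1 !natrB // -natr1; ring.
Qed.

Lemma size_index_enum_ord k : size (index_enum 'I_k) = k.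
Proof. by rewrite -[RHS]card_ord cardT enumT. Qed.

Lemma lead_coef_binom_poly (c : rat) k :
  lead_coef (binom_poly ('X + c%:P) k) = k`!%:R^-1.
Proof.
by rewrite binom_polyE lead_coefZ (monicP (monic_prod_XsubC _ _ _)) mulr1.
Qed.

Lemma size_binom_poly (c : rat) k : size (binom_poly ('X + c%:P) k) = k.+1.
Proof.
rewrite binom_polyE size_scale ?invr_eq0 ?fact_neq0 // size_prod_XsubC.
by rewrite size_index_enum_ord.
Qed.

(** The summands have equal leading coefficients, which do not cancel. *)
Lemma size_sum_binom cs k : cs != [::] -> size (sum_binom cs k) = k.+1.
Proof.
move=> cs_n0; apply/eqP; rewrite eqn_leq; apply/andP; split.
  apply: (leq_trans (size_sum _ _ _)); apply/bigmax_leqP_seq => c _ _.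
  by rewrite size_binom_poly.
rewrite ltnNge; apply/negP=> /(nth_default 0)/eqP; apply/negP.
rewrite coef_sum (eq_bigr (fun _ => k`!%:R^-1)) => [|c _].
  rewrite big_const_seq count_predT iter_addr_0 mulrn_eq0 size_eq0.
  by rewrite (negPf cs_n0) invr_eq0 fact_neq0.
by rewrite -(lead_coef_binom_poly c.+1%:R) lead_coefE size_binom_poly.
Qed.

(** * Denominators *)

Lemma polyOver_intB (p q : {poly rat}) :
  p \is a polyOver Num.int -> q \is a polyOver Num.int ->
  p - q \is a polyOver Num.int.
Proof.
move=> /polyOverP p_int /polyOverP q_int; apply/polyOverP=> i.
by rewrite coefB rpredB.
Qed.

(** The multipliers that clear the denominators form an ideal, whose least
positive element divides the others. *)
Lemma den_dvd (f : {poly rat}) D :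
  (0 < D)%N -> D%:R *: f \is a polyOver Num.int -> (den f %| D)%N.
Proof.
rewrite /den; case: ex_minnP => d /andP[d_gt0 d_int] d_min D_gt0 D_int.
rewrite /dvdn; case: posnP => // r_gt0.
have: (d <= D %% d)%N; last by rewrite leqNgt ltn_mod d_gt0.
apply: d_min; rewrite r_gt0 /=.
have -> : (D %% d)%:R = D%:R - (D %/ d)%:R * d%:R :> rat.
  by rewrite {2}(divn_eq D d) natrD natrM addrAC subrr add0r.
rewrite scalerBl -scalerA; apply: polyOver_intB => //.
by rewrite polyOverZ // natr_int.
Qed.

(** The leading term of [s] is integral because that of [M * s] is; removing it
lowers the size. *)
Lemma monic_factor_int (M s : {poly rat}) :
    M \is monic -> M \is a polyOver Num.int -> M * s \is a polyOver Num.int ->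
  s \is a polyOver Num.int.
Proof.
move=> M_monic M_int; have [n] := ubnP (size s); elim: n s => // n IHn s s_n Ms_int.
have [->|s_n0] := eqVneq s 0; first exact: polyOver0.
pose t := lead_coef s *: 'X^((size s).-1).
have t_int : t \is a polyOver Num.int.
  rewrite polyOverZ ?polyOverXn // -(lead_coef_monicM _ M_monic).
  by rewrite lead_coefE; apply: (polyOverP Ms_int).
rewrite -(subrK t s); apply: (polyOver_addr_closed _).2 => //.
apply: IHn; last by rewrite mulrBr; apply: polyOver_intB => //; apply: polyOver_mulr_2closed.
apply: leq_trans (_ : size s <= n)%N; last by [].
rewrite [X in (_ < X)%N]polySpred // ltnS; apply/leq_sizeP => j.
rewrite coefB coefZ coefXn leq_eqVlt => /orP[/eqP<-|j_gt].
  by rewrite eqxx mulr1 subrr.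
by rewrite gtn_eqF // mulr0 subr0 nth_default // polySpred.
Qed.

Lemma e_ge a : (2 <= a)%N -> (a <= e_ a)%N.
Proof.
move=> a_ge2; rewrite /e_ leq_divRL // -mulnn.
by have : (2 * a <= a * a)%N; [rewrite leq_mul2r a_ge2 orbT | lia].
Qed.

Lemma m_split a : (2 <= a)%N -> e_ a = (m_ a + a.-1 + beta_ a)%N.
Proof.
by move=> a_ge2; have := e_ge a_ge2; rewrite /m_ /beta_; case: ifP => _; lia.
Qed.

(** This is what fixes [beta_ a]: the parity of [e_ a - a + 1] depends on [a]
modulo [4] only. *)
Lemma m_even a : (2 <= a)%N -> ~~ odd (m_ a).
Proof.
move=> a_ge2; have := m_split a_ge2; move: (m_ a) => m.
rewrite /beta_ /e_ -mulnn; have := ltn_pmod a (isT : 0 < 4)%N.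
have {2 3 4}-> := divn_eq a 4; move: (a %/ 4)%N (a %% 4)%N => b r r_lt.
have -> : ((b * 4 + r + 1) * (b * 4 + r + 1) =
   (4 * (b * b) + 2 * b * (r + 1)) * 4 + (r + 1) * (r + 1))%N by lia.
by rewrite divnMDl //; case: r r_lt => [|[|[|[|]]]] //= _; lia.
Qed.

Lemma den_boundE a : (2 <= a)%N ->
  (den_bound a)%:R = (odd a).+1%:R ^+ m_ a * ((e_ a)`!%:R / (a.-1)`!%:R) :> rat.
Proof.
move=> a_ge2; have le_e : (a.-1 <= e_ a)%N by have := e_ge a_ge2; lia.
have dvd_e : ((a.-1)`! %| (e_ a)`!)%N.
  by apply/dvdnP; exists ('C(e_ a, a.-1) * (e_ a - a.-1)`!)%N; rewrite mulnAC -mulnA bin_fact.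
by rewrite -natf_div // /den_bound; case: (odd a); rewrite ?natrM ?natrX ?expr1n ?mul1r.
Qed.

Lemma scaled_binom_poly (q u v : rat) k : q != 0 ->
  (k`!%:R * q ^+ k) *: (binom_poly ('X + u%:P) k \Po (q^-1 *: ('X - v%:P))) =
  \prod_(i < k) ('X - (v + q * (i%:R - u))%:P).
Proof.
move=> q_n0; rewrite binom_polyE comp_polyZ scalerA mulrAC mulfV ?fact_neq0 // mul1r.
rewrite rmorph_prod -[X in q ^+ X](card_ord k) -prodr_const -scaler_prod.
apply: eq_bigr => i _.
rewrite /= comp_polyB comp_polyX comp_polyC [LHS]scalerBr scalerA mulfV // scale1r.
by rewrite -[q *: _%:P]mul_polyC -polyCM polyCD opprD addrA.
Qed.

Lemma prod_XsubC_int k (r : nat -> rat) : (forall i, r i \is a Num.int) ->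
  \prod_(i < k) ('X - (r i)%:P) \is a polyOver Num.int.
Proof.
move=> r_int; apply: (big_ind (fun p : {poly rat} => p \is a polyOver Num.int)).
- exact: polyOver_mul1_closed.
- by move=> p t; apply: polyOver_mulr_2closed.
by move=> i _; rewrite polyOverXsubC.
Qed.

(** Substituting ['X / q] for ['X], where [q * a / 2] is an integer, makes every
linear factor on both sides integral up to the factor [q]; the powers of [q]
that remain in excess make up the power of two in [den_bound]. *)
Lemma den_bound_int a cs s : (2 <= a)%N ->
    sum_binom cs (e_ a) \Po ('X - (a%:R / 2%:R)%:P) =
      'X ^+ beta_ a * binom_poly ('X + (a%:R / 2%:R)%:P - 1) a.-1 * s ->
  (den_bound a)%:R *: s \is a polyOver Num.int.
Proof.
move=> a_ge2 factE; set half := a%:R / 2%:R in factE.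
pose q : rat := (odd a).+1%:R; have q_n0 : q != 0 by rewrite pnatr_eq0.
have [g gE] : exists g : nat, q * half = g%:R.
  exists ((odd a).+1 * a %/ 2)%N; rewrite /q /half natf_div; last lia.
  by rewrite natrM mulrA.
pose z : {poly rat} := q^-1 *: 'X.
pose D : rat := (den_bound a)%:R.
pose M : {poly rat} :=
  'X ^+ beta_ a * \prod_(i < a.-1) ('X - (0 + q * (i%:R - (half - 1)))%:P).
have M_monic : M \is monic by rewrite monicMl ?monicXn // monic_prod_XsubC.
have M_int : M \is a polyOver Num.int.
  apply: polyOver_mulr_2closed; first exact: polyOverXn.
  apply: (@prod_XsubC_int _ (fun i => 0 + q * (i%:R - (half - 1)))) => i.
  have -> : 0 + q * (i%:R - (half - 1)) = q * (i%:R + 1) - g%:R by rewrite -gE; ring.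
  by rewrite rpredB ?rpredM ?rpredD ?natr_int ?rpred1.
have Ds_int : D *: (s \Po z) \is a polyOver Num.int.
  apply: (monic_factor_int M_monic M_int).
  have -> : M * (D *: (s \Po z)) =
      \sum_(c <- cs) \prod_(i < e_ a) ('X - (g%:R + q * (i%:R - c.+1%:R))%:P).
    have zE : ('X - half%:P) \Po z = q^-1 *: ('X - g%:R%:P).
      rewrite comp_polyB comp_polyX comp_polyC scalerBr -gE; congr (_ - _).
      by rewrite -mul_polyC -polyCM mulKf.
    transitivity (((e_ a)`!%:R * q ^+ e_ a) *:
        ((sum_binom cs (e_ a) \Po ('X - half%:P)) \Po z)); last first.
      rewrite /sum_binom !raddf_sum; apply: eq_bigr => c _ /=.
      by rewrite -comp_polyA zE scaled_binom_poly.
    rewrite factE.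
    rewrite !comp_polyM rmorphXn /= comp_polyX.
    have -> : 'X + half%:P - 1 = 'X + (half - 1)%:P by rewrite polyCB addrA.
    rewrite /M -scaled_binom_poly // subr0 -/z {1}/z exprZn.
    rewrite -!scalerAl -!scalerAr -!scalerAl !scalerA.
    congr (_ *: _).
    rewrite /D den_boundE // -/q {3}m_split // !exprD exprVn.
    by field; rewrite fact_neq0 /= expf_neq0.
  apply: (big_ind (fun p : {poly rat} => p \is a polyOver Num.int)) => [|t u|c _].
  - exact: polyOver0.
  - exact: (polyOver_addr_closed _).2.
  apply: (@prod_XsubC_int _ (fun i => g%:R + q * (i%:R - c.+1%:R))) => i.
  by rewrite rpredD ?rpredM ?rpredB ?natr_int.
have -> : D *: s = (D *: (s \Po z)) \Po (q *: 'X).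
  by rewrite comp_polyZ -comp_polyA /z comp_polyZ comp_polyX scalerA mulVf // scale1r comp_polyXr.
by apply: polyOver_comp => //; rewrite polyOverZ ?polyOverX ?natr_int.
Qed.

(** * The factorisation *)

Lemma prod_XsubC_reflect k (r : nat -> rat) :
    (forall i, (i < k)%N -> r (k - i.+1)%N = - r i) ->
  \prod_(i < k) ('X - (r i)%:P) \Po (- 'X) =
  (-1) ^+ k * \prod_(i < k) ('X - (r i)%:P).
Proof.
move=> r_anti; rewrite rmorph_prod (reindex_inj rev_ord_inj) /=.
rewrite -[X in (-1) ^+ X](card_ord k) -prodrN; apply: eq_bigr => i _.
by rewrite comp_polyB comp_polyX comp_polyC r_anti ?ltn_ord // polyCN; ring.
Qed.

(** In the variable centred at [- a / 2], the polynomial [P] has the parity of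
[e_ a] and the product of the known linear factors that of [a - 1]. *)
Lemma factor_exists a (P : {poly rat})
    (M := 'X ^+ beta_ a * binom_poly ('X + (a%:R / 2%:R)%:P - 1) a.-1) :
    (2 <= a)%N ->
    P \Po (- 'X - a%:R%:P) = (-1) ^+ e_ a *: P ->
    (forall k, (k < a.-1)%N -> P.[- 1 - k%:R] = 0) ->
  exists2 s, even_polynomial s & P \Po ('X - (a%:R / 2%:R)%:P) = M * s.
Proof.
move=> a_ge2 P_refl P_root; set half := a%:R / 2%:R in M *.
pose r i : rat := i%:R - (half - 1).
pose B := \prod_(i < a.-1) ('X - (r i)%:P).
have halfD : half + half = a%:R by rewrite /half; field.
have B_refl : B \Po (- 'X) = (-1) ^+ a.-1 * B.
  apply: prod_XsubC_reflect => i i_lt; rewrite /r natrB //.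
  have -> : (a.-1)%:R = half + half - 1 by rewrite halfD -subn1 natrB //; lia.
  by rewrite -natr1; ring.
have B_n0 : B != 0 by rewrite monic_neq0 // monic_prod_XsubC.
set R := P \Po _.
have R_refl : R \Po (- 'X) = (-1) ^+ e_ a * R.
  rewrite /R -comp_polyA.
  have -> : ('X - half%:P) \Po (- 'X) = (- 'X - a%:R%:P) \Po ('X - half%:P).
    rewrite !comp_polyB rmorphN /= comp_polyX !comp_polyC comp_polyX -halfD polyCD; ring.
  rewrite comp_polyA P_refl comp_polyZ -mul_polyC; congr (_ * _).
  by rewrite rmorphXn rmorphN rmorph1.
have /dvdpP[Q QE] : B %| R.
  have -> : B = \prod_(z <- [seq r i | i <- iota 0 a.-1]) ('X - z%:P).
    by rewrite big_map -{1}[a.-1]subn0 big_mkord.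
  apply: uniq_roots_dvdp.
    apply/allP=> _ /mapP[i + ->]; rewrite mem_iota /= => i_lt.
    rewrite rootE /R horner_comp !hornerE.
    have -> : r i - half = - 1 - (a.-1 - i.+1)%:R.
      rewrite /r natrB // -natr1.
      have -> : (a.-1)%:R = half + half - 1 by rewrite halfD -subn1 natrB //; lia.
      ring.
    by rewrite P_root //; lia.
  rewrite uniq_rootsE map_inj_uniq ?iota_uniq // => i j /addIr /eqP.
  by rewrite eqr_nat => /eqP.
have Q_refl : Q \Po (- 'X) = (-1) ^+ beta_ a * Q.
  have sgnB_n0 : (-1) ^+ a.-1 * B != 0 by rewrite mulf_neq0 // expf_neq0 // oppr_eq0 oner_eq0.
  apply: (mulIf sgnB_n0); rewrite -{1}B_refl -comp_polyM -QE R_refl QE.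
  have -> : (-1) ^+ e_ a = (-1) ^+ a.-1 * (-1) ^+ beta_ a :> {poly rat}.
    by rewrite m_split // !exprD -[(-1) ^+ m_ a]signr_odd (negPf (m_even a_ge2)) mul1r.
  by ring.
(* An odd polynomial vanishes at 0. *)
have [s sE] : exists s, Q = 'X ^+ beta_ a * s.
  move: Q_refl; rewrite /beta_; case: ifP => _ Q_refl; first by exists Q; rewrite mul1r.
  have /dvdpP[s ->] : 'X - 0%:P %| Q; last by exists s; rewrite subr0 mulrC.
  rewrite dvdp_XsubCl rootE; have := congr1 (fun p => p.[0]) Q_refl.
  rewrite horner_comp !hornerE oppr0 => /eqP.
  by rewrite mulN1r -addr_eq0 -mulr2n mulrn_eq0.
exists ((a.-1)`!%:R *: s).
  rewrite /even_polynomial comp_polyZ; congr (_ *: _).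
  have X_n0 : (- 'X : {poly rat}) ^+ beta_ a != 0 by rewrite expf_neq0 // oppr_eq0 polyX_eq0.
  apply: (mulfI X_n0); move: Q_refl; rewrite sE comp_polyM rmorphXn /= comp_polyX => ->.
  by rewrite mulrA -exprMn mulN1r.
have -> : M = (a.-1)`!%:R^-1 *: ('X ^+ beta_ a * B).
  rewrite /M scalerAr /B -binom_polyE; congr (_ * binom_poly _ _).
  by rewrite polyCB addrA.
rewrite -scalerAl -scalerAr scalerA mulVf ?fact_neq0 // scale1r QE sE.
by rewrite mulrAC.
Qed.

(* A polynomial of degree d has size d.+1. *)
Theorem theorem1p5 (a : nat) (ha : (2 <= a)%N) :
  exists P : {poly rat},
    [/\ unique (extends_S a) P,
        size P = (e_ a).+1 &
        exists s : {poly rat},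
          [/\ unique (factor_s a P) s,
              size s = (m_ a).+1 &
              (den s %| den_bound a)%N]].
Proof.
have [cs [cs_n0 cs_lt csE cs_small cs_shift]] := S_count_binomials ha.
pose P := sum_binom cs (e_ a).
have P_S : extends_S a P by move=> h; rewrite horner_sum_binom -csE.
have P_size : size P = (e_ a).+1 by apply: size_sum_binom.
exists P; split=> //; first by split=> // P' P'_S; apply: poly_eq_nat => h; rewrite P_S P'_S.
have [||s s_even factE] := @factor_exists a P ha.
- apply: poly_eq_nat => h; rewrite horner_comp hornerZ !hornerE P_S.
  have -> : - h%:R - a%:R = - 1 - (a.-1 + h)%:R :> rat.
    by rewrite natrD -subn1 natrB; [ring | lia].
  by rewrite horner_sum_binom_neg // cs_shift.
- by move=> k k_lt; rewrite horner_sum_binom_neg // cs_small // mulr0.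
set M := 'X ^+ _ * _ in factE.
have R_size : size (M * s) = (e_ a).+1.
  rewrite -factE size_comp_poly2 //.
  exact: size_XsubC.
have s_n0 : s != 0 by apply/eqP=> s0; rewrite s0 mulr0 size_poly0 in R_size.
have M_size : size M = (beta_ a + a)%N.
  rewrite /M (_ : 'X + _ - 1 = 'X + (a%:R / 2%:R - 1)%:P); last by rewrite polyCB addrA.
  have B_size := size_binom_poly (a%:R / 2%:R - 1) a.-1.
  rewrite size_monicM ?monicXn //; last by rewrite -size_poly_eq0 B_size.
  rewrite B_size size_polyXn; lia.
have M_n0 : M != 0.
  by apply/eqP=> M0; rewrite M0 mul0r size_poly0 in R_size.
exists s; split; first split=> //.
- by move=> s' [_ _ factE']; apply: (mulfI M_n0); rewrite -factE -factE'.
- move: R_size (m_split ha) (ha); rewrite size_mul // M_size.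
  by move: (e_ a) (m_ a) (beta_ a) (size s) => e m b k; lia.
apply: den_dvd; last exact: den_bound_int ha factE.
rewrite -(ltr0n rat) den_boundE //.
by rewrite mulr_gt0 ?exprn_gt0 ?divr_gt0 ?ltr0n ?fact_gt0.
Qed.
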